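(* Let $\gamma$ be a cardinal with $\gamma>\aleph_0$, let $G$ be an Abelian group of cardinality $\gamma$, and let $F_\gamma$ be the free group of rank $\gamma$. Let $\kappa$ be a cardinal such that either $\aleph_0<\kappa<\gamma$, or $\kappa=\gamma$ and $\gamma$ is a singular cardinal. Then $G$ is not $\kappa$-coarsely equivalent to $F_\gamma$. In particular, $G$ and $F_\gamma$ are not $\kappa$-asymorphic.
   Context: A ball structure is a triple $\mathcal{B}=(X,P,B)$ where $X,P$ are non-empty sets and, for all $x\in X$ and $\alpha\in P$, $B(x,\alpha)$ is a subset of $X$ with $x\in B(x,\alpha)$ (the ball of radius $\alpha$ around $x$). Put $B^*(x,\alpha)=\{y\in X: x\in B(y,\alpha)\}$ and $B(A,\alpha)=\bigcup_{a\in A}B(a,\alpha)$ for $A\subseteq X$. A ball structure is a ballean if: (i) for any $\alpha,\beta\in P$ there exist $\alpha',\beta'\in P$ such that for every $x\in X$, $B(x,\alpha)\subseteq B^*(x,\alpha')$ and $B^*(x,\beta)\subseteq B(x,\beta')$; (ii) for any $\alpha,\beta\in P$ there exists $\rho\in P$ such that for every $x\in X$, $B(B(x,\alpha),\beta)\subseteq B(x,\rho)$; (iii) for any $x,y\in X$ there exists $\alpha\in P$ with $y\in B(x,\alpha)$. For balleans $\mathcal{B}=(X,P,B)$ and $\mathcal{B}'=(X',P',B')$, a mapping $f:X\to X'$ is a $\prec$-mapping if for every $\alpha\in P$ there exists $\alpha'\in P'$ such that $f(B(x,\alpha))\subseteq B'(f(x),\alpha')$ for every $x\in X$. A bijection $f:X\to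 X'$ is an asymorphism if both $f$ and $f^{-1}$ are $\prec$-mappings; then $\mathcal{B}$ and $\mathcal{B}'$ are called asymorphic. Each non-empty subset $Y\subseteq X$ defines the subballean $\mathcal{B}_Y=(Y,P,B_Y)$ with $B_Y(y,\alpha)=Y\cap B(y,\alpha)$. A subset $Y\subseteq X$ is large if $X=B(Y,\alpha)$ for some $\alpha\in P$. Balleans $\mathcal{B}$ and $\mathcal{B}'$ with supports $X$ and $X'$ are coarsely equivalent if there exist large subsets $Y\subseteq X$ and $Y'\subseteq X'$ such that the subballeans $\mathcal{B}_Y$ and $\mathcal{B}'_{Y'}$ are asymorphic. For an infinite group $G$ with identity $e$ and an infinite cardinal $\kappa\le|G|$, let $[G]^{<\kappa}=\{A\subseteq G:|A|<\kappa\}$, and let $(G,[G]^{<\kappa})$ denote the ballean with support $G$, set of radii $[G]^{<\kappa}$, and balls $B(g,A)=(A\cup\{e\})g$. Groups $G$ and $H$ are $\kappa$-asymorphic (respectively $\kappa$-coarsely equivalent) if the balleans $(G,[G]^{<\kappa})$ and $(H,[H]^{<\kappa})$ are asymorphic (respectively coarsely equivalent). *)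

(* Defs.v *)
From HB Require Import structures.
From mathcomp Require Import all_boot monoid.
From mathcomp Require Import boolp classical_sets functions cardinality wochoice.

Set Implicit Arguments.
Unset Strict Implicit.
Unset Printing Implicit Defensive.

Local Open Scope classical_set_scope.
Local Open Scope card_scope.

Definition card_lt (T U : Type) (A : set T) (B : set U) : Prop :=
  A #<= B /\ ~ (B #<= A).

(* Cardinals are represented by types: the type [T] stands for the cardinal  *)
(* of [[set: T]]. The conditions on [R] alone say that [R] orders [T] as the *)
(* initial ordinal of |T|; the cofinal set [C] witnesses cf(|T|) < |T|.      *)
Definition singular (T : Type) : Prop :=
  infinite_set [set: T] /\
  exists R : rel T,
    [/\ well_order R,
        forall x, card_lt [set y | ~~ R x y] [set: T]
      & exists C : set T,
          card_lt C [set: T] /\ forall x, exists2 c, C c & R x c].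

(* Asymorphisms and coarse equivalences only refer to the triple (X, P, B),  *)
(* so the axioms are kept apart, in [is_ballean].                            *)
Record ball_structure := BallStructure {
  bs_support : Type;
  bs_radius : Type;
  bs_ball : bs_support -> bs_radius -> set bs_support }.

Arguments bs_ball {b} x a.

Definition ball_star (B : ball_structure) (x : bs_support B)
    (a : bs_radius B) : set (bs_support B) :=
  [set y | bs_ball y a x].

Definition ball_set (B : ball_structure) (A : set (bs_support B))
    (a : bs_radius B) : set (bs_support B) :=
  \bigcup_(x in A) bs_ball x a.

Definition is_ball_structure (B : ball_structure) : Prop :=
  [/\ inhabited (bs_support B), inhabited (bs_radius B)
    & forall (x : bs_support B) (a : bs_radius B), bs_ball x a x].

Definition is_ballean (B : ball_structure) : Prop :=
  [/\ is_ball_structure B,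
      forall a b : bs_radius B, exists a' b' : bs_radius B,
        forall x : bs_support B,
        bs_ball x a `<=` ball_star x a' /\ ball_star x b `<=` bs_ball x b',
      forall a b : bs_radius B, exists r : bs_radius B,
        forall x : bs_support B,
        ball_set (bs_ball x a) b `<=` bs_ball x r
    & forall x y : bs_support B, exists a : bs_radius B, bs_ball x a y].

Definition prec_mapping (B B' : ball_structure)
    (f : bs_support B -> bs_support B') : Prop :=
  forall a : bs_radius B, exists a' : bs_radius B', forall x : bs_support B,
    f @` bs_ball x a `<=` bs_ball (f x) a'.

Definition asymorphic (B B' : ball_structure) : Prop :=
  exists (f : bs_support B -> bs_support B')
         (g : bs_support B' -> bs_support B),
    [/\ cancel f g, cancel g f, prec_mapping f & prec_mapping g].

Definition subballean (B : ball_structure) (Y : set (bs_support B)) :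
    ball_structure :=
  @BallStructure {y : bs_support B | Y y} (bs_radius B)
    (fun y a => [set z | bs_ball (sval y) a (sval z)]).

Definition large (B : ball_structure) (Y : set (bs_support B)) : Prop :=
  exists a : bs_radius B, [set: bs_support B] = ball_set Y a.

Definition coarsely_equivalent (B B' : ball_structure) : Prop :=
  exists (Y : set (bs_support B)) (Y' : set (bs_support B')),
    [/\ Y !=set0, Y' !=set0, large Y, large Y'
      & asymorphic (subballean Y) (subballean Y')].

Definition group_ballean (G : groupType) (K : Type) : ball_structure :=
  @BallStructure G {A : set G | card_lt A [set: K]}
    (fun g A => [set (a * g)%g | a in sval A `|` [set 1%g]]).

Definition asymorphic_groups (K : Type) (G H : groupType) : Prop :=
  asymorphic (group_ballean G K) (group_ballean H K).

Definition coarsely_equivalent_groups (K : Type) (G H : groupType) : Prop :=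
  coarsely_equivalent (group_ballean G K) (group_ballean H K).

(* Universal property: every map from [X] to a group extends to a unique     *)
(* morphism on [F]. A map on [X] is given by its values on [X] as a total    *)
(* function on [F].                                                          *)
Definition free_basis (F : groupType) (X : set F) : Prop :=
  forall (H : groupType) (f : F -> H),
    exists phi : {multiplicative F -> H},
      (forall x, X x -> phi x = f x) /\
      forall psi : {multiplicative F -> H},
        (forall x, X x -> psi x = f x) -> psi =1 phi.

Definition free_group_of_rank (C : Type) (F : groupType) : Prop :=
  exists X : set F, free_basis X /\ X #= [set: C].

(* What follows leads to [subballean_is_ballean] and                         *)
(* [group_ballean_is_ballean]: the structures compared by                    *)
(* [coarsely_equivalent_groups] are balleans for every infinite [K].         *)

Lemma card_leI (T U : Type) (A : set T) (B : set U) (f : T -> U) :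
    (forall x, A x -> B (f x)) ->
    (forall x y, A x -> A y -> f x = f y -> x = y) ->
  A #<= B.
Proof.
move=> fAB finj; have [g gE] := Pfun (fAB : set_fun A B f).
have ginj : set_inj A g.
  by move=> x y /set_mem Ax /set_mem Ay; rewrite -gE => /finj; exact.
by have [h _] := funPinj ginj; exact: (inj_card_le h).
Qed.

Lemma card_leE (T U : Type) (A : set T) (B : set U) (b : U) :
  A #<= B -> exists f : T -> U,
    (forall x, A x -> B (f x)) /\
    (forall x y, A x -> A y -> f x = f y -> x = y).
Proof.
move=> /card_leP[f].
pose g x := if pselect (A x) is left h then val (f (SigSub (mem_set h))) else b.
exists g; split=> [x Ax|x y Ax Ay]; rewrite /g.
  by case: pselect => // h; apply/set_mem/valP.
case: pselect => // h; case: pselect => // h' /val_inj.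
by move=> /(@inj _ _ _ f _ _ (mem_set I) (mem_set I)) /(congr1 val).
Qed.

Lemma card_le_total (T U : Type) (A : set T) (B : set U) :
  A #<= B \/ B #<= A.
Proof.
pose P := [set g : set (T * U) | [/\ g `<=` A `*` B,
  forall x y y', g (x, y) -> g (x, y') -> y = y' &
  forall x x' y, g (x, y) -> g (x', y) -> x = x']].
have [F FP Ftot|g [[gAB gf gi] gmax]] := @Zorn_bigcup _ P.
  have ch p q : (\bigcup_(X in F) X) p -> (\bigcup_(X in F) X) q ->
      exists2 X, F X & X p /\ X q.
    move=> [X FX Xp] [Y FY Yq]; have [XY|YX] := Ftot _ _ FX FY.
      by exists Y => //; split=> //; exact: XY.
    by exists X => //; split=> //; exact: YX.
  split=> [p [X /FP[XAB _ _] /XAB]//|x y y' h h'|x x' y h h'].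
    by have [X /FP[_ Xf _] [Xp Xq]] := ch _ _ h h'; exact: Xf Xp Xq.
  by have [X /FP[_ _ Xi] [Xp Xq]] := ch _ _ h h'; exact: Xi Xp Xq.
have [Adom|/existsNP[a /not_implyP[Aa /forallNP na]]] :=
  pselect (forall x, A x -> exists y, g (x, y)).
  left; have [->|/set0P[a Aa]] := eqVneq A set0; first exact: card_ge0.
  have [b _] := Adom _ Aa.
  have /choice[f fP] : forall x, exists y, A x -> g (x, y).
    by move=> x; have [/Adom[y]|] := pselect (A x); [exists y|exists b].
  apply: (@card_leI _ _ _ _ f) => [x Ax|x y Ax Ay fxy].
    by have [] := gAB _ (fP _ Ax).
  by apply: gi (fP _ Ax) _; rewrite fxy; exact: fP.
have [Bran|/existsNP[b /not_implyP[Bb /forallNP nb]]] :=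
  pselect (forall y, B y -> exists x, g (x, y)).
  right.
  have /choice[f fP] : forall y, exists x, B y -> g (x, y).
    by move=> x; have [/Bran[y]|] := pselect (B x); [exists y|exists a].
  apply: (@card_leI _ _ _ _ f) => [x Ax|x y Ax Ay fxy].
    by have [] := gAB _ (fP _ Ax).
  by apply: gf (fP _ Ax) _; rewrite fxy; exact: fP.
exfalso; apply: (gmax (g `|` [set (a, b)])).
  split=> [p|/(_ (a, b)) h]; first by left.
  by apply: (na b); apply: h; right.
split=> [p [/gAB//|->//]|x y y' [h [h'|[ex ey]]|[ex ey] [h|[_ ->]]]
        |x x' y [h [h'|[ex ey]]|[ex ey] [h|[-> _]]]] //; subst.
- exact: gf h h'.
- by case: (na _ h).
- by case: (na _ h).
- exact: gi h h'.
- by case: (nb _ h).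
- by case: (nb _ h).
Qed.

Lemma card_ltE (T U : Type) (A : set T) (B : set U) :
  card_lt A B <-> ~ (B #<= A).
Proof.
split=> [[]//|nBA]; split=> //.
by have [|/nBA] := card_le_total A B.
Qed.

Lemma card_le_setX (T T' U U' : Type) (A : set T) (A' : set T')
    (B : set U) (B' : set U') :
  A #<= B -> A' #<= B' -> A `*` A' #<= B `*` B'.
Proof.
move=> AB AB'.
have [->|/set0P[[a a'] [/= Aa Aa']]] := eqVneq (A `*` A') set0.
  exact: card_ge0.
have [b0|/set0P[b Bb]] := eqVneq B set0.
  by move: AB; rewrite b0 card_le0 => /eqP A0; move: Aa; rewrite A0.
have [b0|/set0P[b' Bb']] := eqVneq B' set0.
  by move: AB'; rewrite b0 card_le0 => /eqP A0; move: Aa'; rewrite A0.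
have [f [fAB finj]] := card_leE b AB; have [g [gAB ginj]] := card_leE b' AB'.
apply: (@card_leI _ _ _ _ (fun p => (f p.1, g p.2))) => [[x y] [/= ? ?]|].
  by split=> /=; [exact: fAB|exact: gAB].
by move=> [x y] [x' y'] [/= Ax Ay] [/= Ax' Ay'] [/finj-> // /ginj->].
Qed.

Lemma card_le_setU (T U : Type) (A B : set T) (C : set U) :
    infinite_set C -> C `*` C #<= C -> A #<= C -> B #<= C ->
  A `|` B #<= C.
Proof.
move=> Cinf CC AC BC; apply: card_le_trans CC.
have [c _] := infinite_setN0 Cinf.
have NC := (infiniteP C).1 Cinf; have [h [hC hi]] := card_leE c NC.
have [f [fC fi]] := card_leE c AC; have [g [gC gi]] := card_leE c BC.
pose k x := if pselect (A x) then (h 0%N, f x) else (h 1%N, g x).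
apply: (@card_leI _ _ _ _ k) => [x|x y]; rewrite /k.
  case: pselect => [Ax _|nAx ABx]; first by split; [exact: hC|exact: fC].
  by split; [exact: hC|apply: gC; case: ABx].
have h01 : h 0%N <> h 1%N by move=> /(hi _ _ I I).
case: pselect => [Ax|nAx]; case: pselect => [Ay|nAy] // xAB yAB [].
- exact: fi.
- by move/h01.
- by move/esym/h01.
- by apply: gi; [case: xAB|case: yAB].
Qed.

Lemma card_setXX (T : Type) (X : set T) : infinite_set X -> X `*` X #<= X.
Proof.
move=> Xinf; have [x0 Xx0] := infinite_setN0 Xinf.
pose S (g : set (T * T * T)) := [set x | exists z, g (x, x, z)].
pose P := [set g : set (T * T * T) | [/\
  S g `<=` X,
  forall x y z, g (x, y, z) -> [/\ S g x, S g y & S g z],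
  forall x y, S g x -> S g y -> exists z, g (x, y, z),
  (forall x y z z', g (x, y, z) -> g (x, y, z') -> z = z') /\
  (forall p p' z, g (p, z) -> g (p', z) -> p = p') &
  forall x, S g x -> infinite_set (S g)]].
have Smono g g' : g `<=` g' -> S g `<=` S g'.
  by move=> gg' x [z gz]; exists z; exact: gg'.
have [F FP Ftot|g [[gX gS gtot [gf gi] ginf] gmax]] := @Zorn_bigcup _ P.
  have ch p q : (\bigcup_(Y in F) Y) p -> (\bigcup_(Y in F) Y) q ->
      exists2 Y, F Y & Y p /\ Y q.
    move=> [Y FY Yp] [Z FZ Zq]; have [YZ|ZY] := Ftot _ _ FY FZ.
      by exists Z => //; split=> //; exact: YZ.
    by exists Y => //; split=> //; exact: ZY.
  have sub Y : F Y -> S Y `<=` S (\bigcup_(Y in F) Y).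
    by move=> FY; apply: Smono => p Yp; exists Y.
  split=> [x [z [Y FY Yz]]|x y z [Y FY]|x y [z xz] [z' yz]||x [z [Y FY Yz]]].
  - by have [+ _ _ _ _] := FP _ FY; apply; exists z.
  - have [_ YS _ _ _] := FP _ FY => /YS[? ? ?].
    by split; exact: sub FY _ _.
  - have [Y FY [Yx Yy]] := ch _ _ xz yz; have [_ _ Yt _ _] := FP _ FY.
    by have [||w Yw] := Yt x y; [exists z|exists z'|exists w; exists Y].
  - split=> [x y z z'|p p' z] h h'; have [Y FY [Yp Yq]] := ch _ _ h h'.
      by have [_ _ _ [Yf _] _] := FP _ FY; exact: Yf Yp Yq.
    by have [_ _ _ [_ Yi] _] := FP _ FY; exact: Yi Yp Yq.
  - have [_ _ _ _ Yinf] := FP _ FY.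
    apply: sub_infinite_set (sub _ FY) (Yinf x _); by exists z.
have ext (S2 : set T) (k : T * T -> T) : S g `<=` S2 -> S2 `<=` X ->
    infinite_set S2 -> S2 `\` S g !=set0 ->
    (forall p, (S2 `*` S2) p -> (S2 `\` S g) (k p)) ->
    (forall p q, (S2 `*` S2) p -> (S2 `*` S2) q -> k p = k q -> p = q) ->
    False.
  move=> gS2 S2X S2inf [w [S2w ngw]] kS ki.
  pose G := g `|` [set q | [/\ S2 q.1.1, S2 q.1.2,
                          ~ (S g q.1.1 /\ S g q.1.2) & q.2 = k q.1]].
  have SG : S G = S2.
    apply/seteqP; split=> x.
      by move=> [z [gz|[]//]]; apply: gS2; exists z.
    move=> S2x; have [[z gz]|ngx] := pselect (S g x).
      by exists z; left.
    by exists (k (x, x)); right; split=> //= -[].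
  apply: (gmax G).
    split=> [q|Gg]; first by left.
    apply: (ngw); exists (k (w, w)); apply: Gg; right; split=> //= -[[z gz] _].
    by apply: (ngw); exists z.
  split; rewrite ?SG => //.
  - move=> x y z [/gS[? ? ?]|[/= ? ? _ ->]]; first by split; exact: gS2.
    by split=> //; have [] := kS (x, y).
  - move=> x y S2x S2y; have [[gx gy]|ng] := pselect (S g x /\ S g y).
      by have [z gz] := gtot _ _ gx gy; exists z; left.
    by exists (k (x, y)); right.
  - split=> [x y z z'|[x y] [x' y'] z].
      move=> [h|[/= ? ? n ->]] [h'|[/= ? ? n' ->]] //.
      + exact: gf h h'.
      + by case: n'; have [] := gS _ _ _ h.
      + by case: n; have [] := gS _ _ _ h'.
    move=> [h|[/= ? ? n ->]] [h'|[/= ? ? n' e]] //.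
    + exact: gi h h'.
    + have [_ _ gz] := gS _ _ _ h.
      by have [] : (S2 `\` S g) z by rewrite e; exact: kS.
    + have [_ _ gz] := gS _ _ _ h'.
      by have [] : (S2 `\` S g) (k (x, y)) by exact: kS.
    + exact: ki.
have Sinf : infinite_set (S g).
  have [S0|/set0P[x gx]] := eqVneq (S g) set0; last exact: ginf gx.
  exfalso; have NX := (infiniteP X).1 Xinf; have [h [hX hi]] := card_leE x0 NX.
  have hS : range h #<= [set: nat] := card_image_le h setT.
  have hS' : [set: nat] #<= range h.
    by apply: (@card_leI _ _ _ _ h) => [n _|m n _ _ /hi]; [exists n|exact].
  have NN : [set: nat] `*` [set: nat] #<= [set: nat].
    by rewrite setXTT; exact: countableP.
  have /(@card_leE _ _ _ _ x0)[k [kS ki]] : range h `*` range h #<= range h.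
    apply: card_le_trans (card_le_setX hS hS) _.
    exact: card_le_trans NN hS'.
  apply: (ext (range h) k); rewrite ?S0 ?setD0 //.
  - by move=> _ [n _ <-]; exact: hX.
  - exact/infiniteP.
  - by exists (h 0%N), 0%N.
have SS : S g `*` S g #<= S g.
  have /choice[f fP] : forall p, exists z, (S g `*` S g) p -> g (p, z).
    move=> [x y]; have [[/= gx gy]|] := pselect ((S g `*` S g) (x, y)).
      by have [z gz] := gtot _ _ gx gy; exists z.
    by exists x.
  apply: (@card_leI _ _ _ _ f) => [[x y] /fP/gS[]//|p q pS qS fpq].
  by apply: gi (fP _ pS) _; rewrite fpq; exact: fP.
have [XS|SX] := card_le_total (X `\` S g) (S g).
  have XS' : X #<= S g.
    apply: card_le_trans (card_le_setU Sinf SS (card_lexx _) XS).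
    by apply: subset_card_le => x Xx; have [|] := pselect (S g x); [left|right].
  apply: card_le_trans (card_le_setX XS' XS') _.
  exact: card_le_trans SS (subset_card_le gX).
exfalso; have [f [fX fi]] := card_leE x0 SX.
pose S' := f @` S g; pose S2 := S g `|` S'.
have S'S : S' #<= S g := card_image_le f (S g).
have SS' : S g #<= S' by apply: (@card_leI _ _ _ _ f) => // x gx; exists x.
have S2S : S2 #<= S g := card_le_setU Sinf SS (card_lexx _) S'S.
have /(@card_leE _ _ _ _ x0)[k [kS ki]] : S2 `*` S2 #<= S'.
  by apply: card_le_trans (card_le_setX S2S S2S) (card_le_trans SS SS').
have S'D : S' `<=` S2 `\` S g.
  by move=> x S'x; split; [right|case: S'x => y /fX[_ +] <-].
apply: (ext S2 k) => //.
- by move=> x; left.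
- by move=> x [/gX//|[y /fX[? _] <-]].
- by apply: sub_infinite_set Sinf => x; left.
- have [x gx] := infinite_setN0 Sinf; exists (f x); apply: S'D; by exists x.
- by move=> p /kS/S'D.
Qed.

Section below.
Variables (T U : Type) (K : set U).
Hypothesis Kinf : infinite_set K.

Let notle (V : Type) (A : set V) : card_lt A K -> ~ (K #<= A).
Proof. by case. Qed.

Lemma finite_card_lt (V : Type) (A : set V) : finite_set A -> card_lt A K.
Proof.
move=> fA; apply/card_ltE => KA; apply: Kinf.
exact: card_le_finite KA fA.
Qed.

Lemma card_lt_setX (A B : set T) :
  card_lt A K -> card_lt B K -> card_lt (A `*` B) K.
Proof.
move=> AK BK; wlog AB : A B AK BK / A #<= B => [wl|].
  have [/wl|BA] := card_le_total A B; first exact.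
  have /card_ltE h := wl _ _ BK AK BA; apply/card_ltE => KAB; apply: h.
  apply: card_le_trans KAB _.
  by apply: (@card_leI _ _ _ _ (fun p => (p.2, p.1))) => [[x y] []|
    [x y] [x' y'] _ _ [-> ->]].
have [Bfin|Binf] := pselect (finite_set B).
  apply: finite_card_lt; apply: finite_setX => //.
  exact: card_le_finite AB Bfin.
apply/card_ltE => KAB; apply: (notle BK); apply: card_le_trans KAB _.
apply: card_le_trans (card_setXX Binf).
exact: card_le_setX AB (card_lexx _).
Qed.

Lemma card_lt_setU (A B : set T) :
  card_lt A K -> card_lt B K -> card_lt (A `|` B) K.
Proof.
move=> AK BK; wlog AB : A B AK BK / A #<= B => [wl|].
  have [/wl|BA] := card_le_total A B; first exact.
  by rewrite setUC; exact: wl.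
have [Bfin|Binf] := pselect (finite_set B).
  by apply: finite_card_lt; rewrite finite_setU; split=> //;
    exact: card_le_finite AB Bfin.
apply/card_ltE => KAB; apply: (notle BK); apply: card_le_trans KAB _.
exact: card_le_setU Binf (card_setXX Binf) AB (card_lexx _).
Qed.

Lemma card_lt_image (V : Type) (f : T -> V) (A : set T) :
  card_lt A K -> card_lt (f @` A) K.
Proof.
move=> /card_ltE AK; apply/card_ltE => Kf; apply: AK.
exact: card_le_trans Kf (card_image_le f A).
Qed.

End below.

Lemma subballean_is_ballean (B : ball_structure) (Y : set (bs_support B)) :
  is_ballean B -> Y !=set0 -> is_ballean (subballean Y).
Proof.
move=> [[_ r0 b1] B1 B2 B3] [y Yy]; split.
- by split=> [||x a]; [exists; exists y|exact: r0|exact: b1].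
- move=> a b; have [a' [b' h]] := B1 a b; exists a', b' => x.
  by have [h1 h2] := h (sval x); split=> z; [exact: h1|exact: h2].
- move=> a b; have [r h] := B2 a b; exists r => x z [w xw wz].
  by apply: (h (sval x)); exists (sval w).
- by move=> x z; exact: B3.
Qed.

Lemma group_ballean_is_ballean (G : groupType) (K : Type) :
  infinite_set [set: K] -> is_ballean (group_ballean G K).
Proof.
move=> Kinf.
pose rad (A : set G) (AK : card_lt A [set: K]) : bs_radius (group_ballean G K) :=
  exist (fun A : set G => card_lt A [set: K]) A AK.
have lt1 (g : G) : card_lt [set g] [set: K].
  exact: finite_card_lt.
have ltV (A : set G) : card_lt A [set: K] ->
    card_lt [set (a^-1)%g | a in A `|` [set 1%g]] [set: K].
  by move=> ?; apply: card_lt_image; apply: card_lt_setU.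
split.
- split=> [||g A /=]; [exists; exact: 1%g|exists; exact: rad (lt1 1%g)|].
  by exists 1%g; [right|rewrite mul1g].
- move=> [A AK] [B BK]; exists (rad _ (ltV _ AK)), (rad _ (ltV _ BK)) => g.
  split=> [_ [a Aa <-]|h [b Bb <-]] /=.
    by exists (a^-1)%g; [left; exists a|rewrite mulKg].
  by exists (b^-1)%g; [left; exists b|rewrite mulKg].
- move=> [A AK] [B BK].
  have lt : card_lt [set (p.2 * p.1)%g | p in (A `|` [set 1%g]) `*` (B `|` [set 1%g])]
      [set: K].
    by apply: card_lt_image; apply: card_lt_setX => //; apply: card_lt_setU.
  exists (rad _ lt) => g h [_ [a Aa <-] [b Bb <-]] /=.
  by exists (b * a)%g; [left; exists (a, b)|rewrite mulgA].
- move=> g h; exists (rad _ (lt1 (h / g)%g)).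
  by exists (h / g)%g; [left|rewrite mulgVK].
Qed.

(* Main.v *)
Require Import Defs.
From HB Require Import structures.
From mathcomp Require Import all_boot monoid perm.
From mathcomp Require Import boolp classical_sets functions cardinality wochoice.

(** Call a set small when its cardinality is less than that of [K]. In an
    abelian group [G], a product [s * a] is at bounded distance both from [a],
    when [s] is fixed, and from [s], uniformly for [a] in a given small set.
    Balls in a group are translates on one side only, so the second property
    comes from commutativity, and both survive a coarse equivalence: they give
    a map [P : F -> F -> F] such that the quotients [P s a / a] form a small set
    for each [s], and the quotients [P s a / s] with [a] in a small set form a
    small set ([almost_product]).

    In a free group no element [w] looks like both [_ * a] and [_ * t] for
    distinct basis elements [a] and [t]: the letter [a] occurs in [w / a] or the
    letter [t] occurs in [w / t] ([free_basis_letters]). Indeed, if neither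
    happens, then killing [a] in [w = (w / a) * a] gives [w / a], killing [t]
    gives [w / t], and killing both in [w = u * a = v * t] shows that
    [w = m * t * a = m * a * t] with the same [m], although distinct basis
    elements do not commute. Here a letter [x] occurs in [g] when the
    endomorphism of [F] that kills [x] moves [g]; only finitely many letters
    occur in [g].

    Let [A a] be the set of letters that occur in some [P t a / t], and let
    [B t] consist of [t] and of the letters that occur in some [P t a / a]. As
    [K] is uncountable, these sets are small, and it remains to find basis
    elements [a] and [t] with [a] outside [B t] and [t] outside [A a]. If |K|
    is less than the rank, |K| many [a] have small sets [A a] that do not cover
    the basis, and any [t] outside them works ([free_pair_lt]). For |K| equal
    to the rank this fails for general set mappings (both may be initial
    segments of a regular cardinal); singularity, together with the uniformity
    of the smallness of [A a] over small sets of [a], gives one cardinal less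
    than |K| that bounds all the sets [A a] ([free_pair_singular]). *)

Set Implicit Arguments.
Unset Strict Implicit.
Unset Printing Implicit Defensive.

Local Open Scope classical_set_scope.
Local Open Scope card_scope.

(** * Cardinal arithmetic *)

Lemma card_lt_le_trans (T U V : Type) (A : set T) (B : set U) (C : set V) :
  card_lt A B -> B #<= C -> card_lt A C.
Proof.
move=> [AB nBA] BC; split; first exact: card_le_trans AB BC.
by move=> CA; apply: nBA; exact: card_le_trans BC CA.
Qed.

Lemma card_le_lt_trans (T U V : Type) (A : set T) (B : set U) (C : set V) :
  A #<= B -> card_lt B C -> card_lt A C.
Proof.
move=> AB [BC nCB]; split; first exact: card_le_trans AB BC.
by move=> CA; apply: nCB; exact: card_le_trans CA AB.
Qed.

(** The union embeds into [J * N], via a choice of an index for each element and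
    of an injection of each [A i] into [N]. *)
Lemma card_lt_bigcup (I M T U : Type) (J : set I) (N : set M) (A : I -> set T)
    (K : set U) : infinite_set K ->
  card_lt J K -> card_lt N K -> (forall i, J i -> A i #<= N) ->
  card_lt (\bigcup_(i in J) A i) K.
Proof.
move=> Kinf JK NK AN.
have [U0|/set0P[x0 [i0 Ji0 Ax0]]] := eqVneq (\bigcup_(i in J) A i) set0.
  by rewrite U0; exact: finite_card_lt.
have [N0|/set0P[m0 _]] := eqVneq N set0.
  have := AN _ Ji0; rewrite N0 card_le0 => /eqP A0.
  by rewrite A0 in Ax0.
have /choice[f fP] : forall i, exists f : T -> M, J i ->
    (forall x, A i x -> N (f x)) /\
    (forall x y, A i x -> A i y -> f x = f y -> x = y).
  move=> i; have [Ji|nJi] := pselect (J i); last by exists (fun=> m0).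
  by have [f fi] := card_leE m0 (AN _ Ji); exists f.
have /choice[h hP] : forall x, exists i,
    (\bigcup_(i in J) A i) x -> J i /\ A i x.
  move=> x; have [[i Ji Aix]|nx] := pselect ((\bigcup_(i in J) A i) x).
    by exists i.
  by exists i0.
have : card_lt ((inl @` J : set (I + M)) `*` (inr @` N : set (I + M))) K.
  by apply: card_lt_setX => //; apply: card_lt_image.
apply: card_le_lt_trans.
apply: (@card_leI _ _ _ _ (fun x => (inl (h x), inr (f (h x) x)))).
  move=> x /hP[Jh Ahx]; split=> /=; first by exists (h x).
  by exists (f (h x) x) => //; exact: (fP _ Jh).1.
move=> x y /hP[Jhx Ax] /hP[_ Ay] [hxy]; rewrite -hxy in Ay *.
exact: (fP _ Jhx).2.
Qed.

(** * Free pairs for two set mappings *)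

Section SetMapping.
Variables (T : Type) (X : set T) (B A : T -> set T).

(** Take |K| many candidates for [a]: the sets [A a] cover at most |K| elements,
    hence miss some [t], and [B t] is too small to contain all candidates. *)
Lemma free_pair_lt (U : Type) (K : set U) :
    infinite_set K -> card_lt K X ->
    (forall t, X t -> card_lt (B t) K) -> (forall a, X a -> card_lt (A a) K) ->
  exists a t, [/\ X a, X t, ~ B t a & ~ A a t].
Proof.
move=> Kinf KX BK AK.
have [x0 _] : X !=set0.
  by apply/set0P/eqP => X0; apply: KX.2; rewrite X0 card_ge0.
have [f [fX fi]] := card_leE x0 KX.1.
have YK : f @` K #<= K := card_image_le f K.
have Xinf : infinite_set X.
  by move=> Xfin; apply: Kinf; exact: card_le_finite KX.1 Xfin.
have [t [Xt tA]] : exists t, X t /\ ~ (\bigcup_(a in f @` K) A a) t.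
  apply: contrapT => /forallNP nt.
  have [_] : card_lt (\bigcup_(a in f @` K) A a) X.
    apply: (card_lt_bigcup Xinf (card_le_lt_trans YK KX) KX) => _ [k /fX Xk <-].
    exact: (AK _ Xk).1.
  apply; apply: subset_card_le => t Xt; apply: contrapT => ?; exact: (nt t).
have [a [Ya Bta]] : exists a, (f @` K) a /\ ~ B t a.
  apply: contrapT => /forallNP na; apply: (BK _ Xt).2.
  apply: (@card_leI _ _ _ _ f) => [k Kk|k l Kk Kl /fi]; last exact.
  by apply: contrapT => ?; apply: (na (f k)); split=> //; exists k.
exists a, t; split=> //; first by case: Ya => k /fX Xk <-.
by move=> Aat; apply: tA; exists a.
Qed.

End SetMapping.

(** * Singular cardinals *)

Lemma well_order_antisym (T : Type) (R : rel T) (x y : T) :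
  well_order R -> R x y -> R y x -> x = y.
Proof.
move=> Rwo Rxy Ryx.
have Rxx z : R z z.
  have [|_ [[/asboolP -> /(_ z)]]] := Rwo [pred u | `[< u = z >]].
    by exists z; apply/asboolP.
  by move=> + _; apply; apply/asboolP.
have [|z [_ zmin]] := Rwo [pred u | `[< u = x \/ u = y >]].
  by exists x; apply/asboolP; left.
have -> : x = z.
  apply/esym/zmin; split; first by apply/asboolP; left.
  by move=> u /asboolP[]->.
apply/zmin; split; first by apply/asboolP; right.
by move=> u /asboolP[]->.
Qed.

(** The covering sets are the closed initial segments given by a short cofinal
    set. *)
Lemma singular_cover (Gamma : Type) : singular Gamma ->
  exists (C : set Gamma) (s : Gamma -> set Gamma),
    [/\ card_lt C [set: Gamma], forall c, card_lt (s c) [set: Gamma]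
      & \bigcup_(c in C) s c = [set: Gamma]].
Proof.
move=> [Ginf [R [Rwo segR [C [CG Ccof]]]]].
exists C, (fun c => [set y | ~~ R c y] `|` [set c]); split=> // [c|].
  by apply: card_lt_setU => //; exact: finite_card_lt.
apply/seteqP; split=> // x _.
have [c Cc Rxc] := Ccof x; exists c => //.
have [Rcx|nRcx] := boolP (R c x); last by left.
by right; exact: well_order_antisym Rwo Rxc Rcx.
Qed.

(** The sizes of the parts of a short cover are cofinal below |Gamma|: if all
    parts had size at most |S|, then |Gamma| <= |C| * |S| < |Gamma|. *)
Lemma cover_bound (Gamma V : Type) (C : set Gamma) (s : Gamma -> set Gamma)
    (S : set V) : infinite_set [set: Gamma] -> card_lt C [set: Gamma] ->
    \bigcup_(c in C) s c = [set: Gamma] -> card_lt S [set: Gamma] ->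
  exists2 c, C c & ~ (s c #<= S).
Proof.
move=> Ginf CG sT SG; apply: contrapT => nS.
have sS c : C c -> s c #<= S.
  by move=> Cc; apply: contrapT => ?; apply: nS; exists c.
have := card_lt_bigcup Ginf CG SG sS.
by rewrite sT => -[_]; apply; exact: card_lexx.
Qed.

(** A uniform bound [s m] on the sets [A a] exists by diagonalization: otherwise
    the union of fewer than |Gamma| many of them would exceed all the sizes
    [s c]. Some size [s j] bounds [B t] for more than |s m| many [t]; fewer than
    |Gamma| of these, but still more than |s m|, are kept as [T']. Then the sets
    [B t] with [t] in [T'] miss some [a], and [A a] is too small to contain
    [T']. *)
Lemma free_pair_singular (Gamma T : Type) (X : set T) (B A : T -> set T) :
    singular Gamma -> X #= [set: Gamma] ->
    (forall t, X t -> card_lt (B t) [set: Gamma]) ->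
    (forall Z, Z `<=` X -> card_lt Z [set: Gamma] ->
       card_lt (\bigcup_(a in Z) A a) [set: Gamma]) ->
  exists a t, [/\ X a, X t, ~ B t a & ~ A a t].
Proof.
move=> sing /card_eqPle[XG GX] BG AG.
have [Ginf _] := sing.
have [C [s [CG sG sT]]] := singular_cover sing.
have sP (V : Type) (S : set V) : card_lt S [set: Gamma] ->
    exists2 c, C c & S #<= s c.
  move=> /(cover_bound Ginf CG sT)[c Cc nsS]; exists c => //.
  by have [] := card_le_total S (s c).
have [x0 _] : X !=set0.
  apply/set0P/eqP => X0; apply: Ginf.
  by move: GX; rewrite X0 card_le0 => /eqP->.
have [m Am] : exists m, forall a, X a -> A a #<= s m.
  apply: contrapT => /forallNP nm.
  have /choice[z zP] : forall c, exists a, X a /\ ~ (A a #<= s c).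
    move=> c; have /existsNP[a /not_implyP[Xa Aa]] := nm c; by exists a.
  have zX : z @` C `<=` X by move=> _ [c _ <-]; exact: (zP c).1.
  have [c Cc Sc] := sP _ _ (AG _ zX (card_lt_image z CG)).
  apply: (zP c).2; apply: card_le_trans Sc; apply: subset_card_le => y Ay.
  by exists (z c) => //; exists c.
have [j [T' [T'G nT'm T'X T'j]]] : exists j T', [/\ card_lt T' [set: Gamma],
    ~ (T' #<= s m), T' `<=` X & forall t, T' t -> B t #<= s j].
  pose Tj j := [set t | X t /\ B t #<= s j].
  have [j nTj] : exists j, ~ (Tj j #<= s m).
    apply: contrapT => /forallNP nj.
    have UG : card_lt (\bigcup_(j in C) Tj j) [set: Gamma].
      by apply: (card_lt_bigcup Ginf CG (sG m)) => j _; apply: contrapT => /nj.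
    apply: UG.2; apply: card_le_trans GX _; apply: subset_card_le => t Xt.
    by have [c Cc Btc] := sP _ _ (BG _ Xt); exists c.
  (* Some T' inside Tj j is larger than s m and smaller than Gamma: either Tj j
     or a copy of s n. *)
  have [n _ nsm] := cover_bound Ginf CG sT (sG m).
  have [Tn|nT] := card_le_total (Tj j) (s n).
    exists j, (Tj j); split=> //; first exact: card_le_lt_trans Tn (sG n).
    - by move=> t [].
    - by move=> t [].
  have [f [fT fi]] := card_leE x0 nT.
  exists j, (f @` s n); split.
  - exact: card_lt_image.
  - move=> fnm; apply: nsm; apply: card_le_trans fnm.
    by apply: (@card_leI _ _ _ _ f) => // k sk; exists k.
  - by move=> _ [k /fT[Xk _] <-].
  - by move=> _ [k /fT[_ Bk] <-].
(* The sets B t with t in T' are uniformly bounded, so they miss some a. *)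
have [a [Xa aB]] : exists a, X a /\ ~ (\bigcup_(t in T') B t) a.
  apply: contrapT => /forallNP na.
  have := card_lt_bigcup Ginf T'G (sG j) T'j.
  move=> [_]; apply; apply: card_le_trans GX _.
  apply: subset_card_le => a Xa; apply: contrapT => ?; exact: (na a).
have [t [T't tA]] : exists t, T' t /\ ~ A a t.
  apply: contrapT => /forallNP nt; apply: nT'm.
  apply: card_le_trans (Am _ Xa); apply: subset_card_le => t T't.
  apply: contrapT => ?; exact: (nt t).
exists a, t; split=> //; first exact: T'X.
by move=> Bta; apply: aB; exists t.
Qed.

(** * Letters in a free group *)

Local Open Scope group_scope.

Lemma multiplicative1 (G H : groupType) (f : {multiplicative G -> H}) : f 1 = 1.
Proof. by apply: (mulgI (f 1)); rewrite -gmulfM !mulg1. Qed.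

Lemma multiplicativeF (G H : groupType) (f : {multiplicative G -> H}) :
  {morph f : x y / x / y}.
Proof. by move=> x y; apply: (mulIg (f y)); rewrite -gmulfM !mulgVK. Qed.

Section FreeGroup.
Variables (F : groupType) (X : set F).
Hypothesis Xfree : free_basis X.

(** Map the two elements to two transpositions that share a point. *)
Lemma free_basis_ncommute (a b : F) : X a -> X b -> a <> b -> a * b <> b * a.
Proof.
move=> Xa Xb ab eab.
pose i (n : nat) : 'I_3 := inord n.
pose s : {perm 'I_3} := tperm (i 0%N) (i 1%N).
pose t : {perm 'I_3} := tperm (i 0%N) (i 2%N).
have [phi [phiX _]] :=
  @Xfree {perm 'I_3} (fun x => if `[< x = a >] then s else t).
have : s * t = t * s.
  have := congr1 phi eab; rewrite !gmulfM !phiX // asboolT //.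
  by rewrite asboolF // => /esym.
have iE m n : (m < 3)%N -> (n < 3)%N -> (i m == i n) = (m == n).
  by move=> m3 n3; rewrite -val_eqE /= !inordK.
move=> /permP/(_ (i 0%N)).
by rewrite !permM !tpermL !tpermD ?iE // => /eqP; rewrite iE.
Qed.

(** The retraction of [F] onto the subgroup [S] given by the universal property
    is the identity, since it fixes the basis. *)
Lemma free_basis_generates (S : pred F) :
  group_closed S -> (forall x, X x -> S x) -> forall g, S g.
Proof.
move=> Scl XS.
pose sT := {x : F | S x}.
pose mG := SubChoice_isSubGroup.Build F S sT Scl.
pose H : groupType := HB.pack sT mG.
pose j (h : H) : F := val (h : sT).
have jM : {morph j : x y / x * y} by [].
pose jm : {multiplicative H -> F} :=
  HB.pack j (isMultiplicative.Build H F j jM).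
(* The default value 1 is only taken outside the basis. *)
have [phi [phiX _]] := @Xfree H (fun x => insubd (1 : H) x).
have [psi [_ psiU]] := @Xfree F id.
move=> g.
have <- : j (phi g) = g.
  have -> : j (phi g) = psi g.
    have := psiU (jm \o phi : {multiplicative F -> F}); apply.
    move=> x Xx /=; rewrite phiX // /j insubdK //. exact: XS.
  exact/esym/(psiU (idfun : {multiplicative F -> F}) (fun x _ => erefl)).
exact: valP.
Qed.

(** [L g] consists of the [x] such that [g] is moved by the endomorphism [k x]
    that sends [x] to 1 and fixes the other basis elements. *)
Lemma free_basis_letters : exists L : F -> set F,
  (forall g, finite_set (L g)) /\
  (forall w a t, X a -> X t -> a <> t -> L (w * a^-1) a \/ L (w * t^-1) t).
Proof.
have /choice[k kX] : forall x, exists k : {multiplicative F -> F},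
    forall y, X y -> k y = if `[< y = x >] then 1 else y.
  move=> x.
  have [k [kX _]] := @Xfree F (fun y => if `[< y = x >] then 1 else y).
  by exists k.
have kxx x : X x -> k x x = 1 by move=> Xx; rewrite kX // asboolT.
have kxy x y : X y -> y <> x -> k x y = y by move=> Xy ?; rewrite kX // asboolF.
exists (fun g => [set x | k x g <> g]); split=> [g|w a t Xa Xt neq_at].
  pose S : pred F := fun g => `[< finite_set [set x | k x g <> g] >].
  suff : S g by move/asboolP.
  apply: free_basis_generates => [|x Xx].
    split=> [|u v /asboolP uS /asboolP vS]; apply/asboolP.
      rewrite (_ : mkset _ = set0) //; apply/seteqP; split=> // x /=.
      by rewrite multiplicative1.
    apply: (@sub_finite_set _ _
      ([set x | k x u <> u] `|` [set x | k x v <> v])).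
      move=> x /= kuv; apply: contrapT => /not_orP[/contrapT ku /contrapT kv].
      by apply: kuv; rewrite multiplicativeF ku kv.
    by rewrite finite_setU.
  apply/asboolP; apply: (@sub_finite_set _ _ [set x]) => // y /= kyx.
  by apply: contrapT => ?; apply: kyx; apply: kxy => // /esym.
apply: contrapT => /not_orP[/contrapT ka /contrapT kt].
apply: (free_basis_ncommute Xa Xt neq_at).
(* Killing a and killing t commute: both composites kill a and t and fix the
   other basis elements. *)
have [psi [_ psiU]] := @Xfree F (k a \o k t).
have kat g : k t (k a g) = k a (k t g).
  transitivity (psi g).
    apply: (psiU (k t \o k a : {multiplicative F -> F})) => x Xx /=.
    have [->|nxa] := pselect (x = a).
      by rewrite kxx // multiplicative1 (kxy t) ?kxx.
    have [->|nxt] := pselect (x = t); last first.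
      by rewrite (kxy a) ?(kxy t) // (kxy a).
    by rewrite (kxy a) // ?kxx // ?multiplicative1 // => /esym.
  exact/esym/(psiU (k a \o k t : {multiplicative F -> F})).
have wa : w = k a w * a.
  by rewrite -{1}(mulgVK a w) -ka multiplicativeF kxx // invg1 mulg1.
have wt : w = k t w * t.
  by rewrite -{1}(mulgVK t w) -kt multiplicativeF kxx // invg1 mulg1.
have ea : k t w = k a (k t w) * a.
  by rewrite {1}wa gmulfM (kxy t a) // kat.
have et : k a w = k a (k t w) * t.
  by rewrite {1}wt gmulfM (kxy a t) // => /esym.
by apply: (mulgI (k a (k t w))); rewrite !mulgA -ea -et -wa.
Qed.
End FreeGroup.

(** * Coarse equivalences of groups *)

Section Coarse.
Variables (K : Type) (Kinf : infinite_set [set: K]).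

Local Notation small A := (card_lt A [set: K]).

Definition prods (G : groupType) (A B : set G) : set G :=
  [set p.1 * p.2 | p in A `*` B].

Lemma prods_mem (G : groupType) (A B : set G) a b :
  A a -> B b -> prods A B (a * b).
Proof. by move=> Aa Bb; exists (a, b). Qed.

Lemma small_prods (G : groupType) (A B : set G) :
  small A -> small B -> small (prods A B).
Proof. by move=> As Bs; apply: card_lt_image; apply: card_lt_setX. Qed.

Lemma small_radius (G : groupType) (A : bs_radius (group_ballean G K)) :
  small (sval A `|` [set 1]).
Proof.
by case: A => A As; apply: card_lt_setU => //; exact: finite_card_lt.
Qed.

Lemma large_retraction (G : groupType)
    (Y : set (bs_support (group_ballean G K))) :
  large Y -> exists (r : G -> {y | Y y}) (R : set G), small R /\
    forall g, R (g / sval (r g)) /\ R (sval (r g) / g).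
Proof.
move=> [A YA]; set A1 := sval A `|` [set 1].
have /choice[r rP] : forall g : G, exists y : {y | Y y}, A1 (g / sval y).
  move=> g; have : [set: G] g by []. rewrite [X in X g]YA => -[y Yy [a Aa <-]].
  by exists (exist _ y Yy); rewrite /= mulgK.
exists r, (A1 `|` [set x^-1 | x in A1]); split=> [|g].
  apply: card_lt_setU => //; first exact: small_radius.
  by apply: card_lt_image; exact: small_radius.
split; first by left.
by right; exists (g / sval (r g)) => //; rewrite invgF.
Qed.

(** For the balleans of [G] and [H], these are the prec-mappings, with
    displacements measured by quotients. *)
Definition bornologous (G H : groupType) (q : G -> H) :=
  forall A : set G, small A -> exists2 D : set H, small D &
    forall a g, A a -> D (q (a * g) / q g).

(** The maps [p] and [q] compose the given asymorphism of large subsets, and its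
    inverse, with maps of bounded displacement onto these subsets. *)
Lemma coarse_inverses (G H : groupType) : coarsely_equivalent_groups K G H ->
  exists (p : H -> G) (q : G -> H), bornologous q /\
    exists2 E : set H, small E & forall x, E (q (p x) / x).
Proof.
move=> [Y [Y' [_ _ /large_retraction[r [R [Rs rR]]]]]].
move=> /large_retraction[r' [R' [Rs' rR']]] [f [g [fK gK fprec _]]].
have fborn (A : set G) : small A -> exists2 D : set H, small D &
    forall y z, A (sval y / sval z) -> D (sval (f y) / sval (f z)).
  move=> As; have [D fD] := fprec (exist _ A As).
  exists (sval D `|` [set 1]); first exact: small_radius.
  move=> y z Ayz.
  suff [d Dd <-] : bs_ball (f z) D (f y) by rewrite mulgK.
  apply: fD; exists y => //; exists (sval y / sval z); first by left.
  by rewrite mulgVK.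
exists (fun x => sval (g (r' x))), (fun x => sval (f (r x))); split.
  move=> A As; have [|D Ds fD] := fborn (prods R (prods A R)).
    by apply: small_prods => //; apply: small_prods.
  exists D => // a x Aa; apply: fD.
  have -> : sval (r (a * x)) / sval (r x) =
      (sval (r (a * x)) / (a * x)) * (a * (x / sval (r x))).
    by rewrite (mulgA a) mulgA mulgVK.
  by apply: prods_mem (rR _).2 (prods_mem Aa (rR _).1).
have [D Ds fD] := fborn _ Rs.
exists (prods D R'); first exact: small_prods.
move=> x; set y := g (r' x).
have -> : sval (f (r (sval y))) / x =
    (sval (f (r (sval y))) / sval (f y)) * (sval (r' x) / x).
  by rewrite gK mulgA mulgVK.
by apply: prods_mem (rR' _).2; apply: fD; exact: (rR _).2.
Qed.

(** Transport the multiplication of [G]: let [P s a] be [q (p s * p a)]. Since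
    [q] is bornologous, the left factor [p s] displaces [q (p a)], which is near
    [a], by an amount that depends on [s] only; by commutativity [p a] can be
    taken as the left factor instead. *)
Lemma almost_product (G H : groupType) : (forall x y : G, x * y = y * x) ->
  coarsely_equivalent_groups K G H ->
  exists P : H -> H -> H,
    (forall s, exists2 D : set H, small D & forall a, D (P s a / a)) /\
    (forall A : set H, small A -> exists2 D : set H, small D &
       forall s a, A a -> D (P s a / s)).
Proof.
move=> mulC /coarse_inverses[p [q [qborn [E Es pqE]]]].
have move_by (A : set H) : small A -> exists2 D : set H, small D &
    forall a x, A a -> D (q (p a * p x) / x).
  move=> As; have [D Ds qD] := qborn (p @` A) (card_lt_image p As).
  exists (prods D E); first exact: small_prods.
  move=> a x Aa.
  have -> : q (p a * p x) / x = (q (p a * p x) / q (p x)) * (q (p x) / x).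
    by rewrite mulgA mulgVK.
  by apply: prods_mem (pqE x); apply: qD; exists a.
exists (fun s a => q (p s * p a)); split=> [s|A /move_by[D Ds DP]].
  have [D Ds DP] := move_by _ (finite_card_lt Kinf (finite_set1 s)).
  by exists D => // a; exact: DP.
by exists D => // s a Aa; rewrite mulC; exact: DP.
Qed.

Lemma asymorphic_coarsely_equivalent (G H : groupType) :
  asymorphic_groups K G H -> coarsely_equivalent_groups K G H.
Proof.
move=> [f [g [fK gK fprec gprec]]].
have largeT (L : groupType) : @large (group_ballean L K) setT.
  exists (exist _ set0 (finite_card_lt Kinf (finite_set0 _))).
  apply/seteqP; split=> // x _; exists x => //; exists 1; first by right.
  by rewrite mul1g.
exists setT, setT; split=> //; try by exists 1.
exists (fun y => exist _ (f (sval y)) I), (fun y => exist _ (g (sval y)) I).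
split.
- by move=> [x []]; rewrite /= fK.
- by move=> [x []]; rewrite /= gK.
- move=> a; have [b ab] := fprec a; exists b => x _ [y xy <-].
  by apply: ab; exists (sval y).
- move=> a; have [b ab] := gprec a; exists b => x _ [y xy <-].
  by apply: ab; exists (sval y).
Qed.
End Coarse.

(** * Letters obstruct almost products *)

Section Obstruction.
Variables (K Gamma : Type) (F : groupType) (X : set F) (P : F -> F -> F).
Hypothesis K_uncountable : card_lt [set: nat] [set: K].
Hypothesis X_free : free_basis X.
Hypothesis X_card : X #= [set: Gamma].
Hypothesis K_range : card_lt [set: K] [set: Gamma]
  \/ [set: K] #= [set: Gamma] /\ singular Gamma.
Hypothesis P_near_right : forall s, exists2 D : set F,
  card_lt D [set: K] & forall a, D (P s a / a).
Hypothesis P_near_left : forall A : set F, card_lt A [set: K] ->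
  exists2 D : set F, card_lt D [set: K] & forall s a, A a -> D (P s a / s).

Lemma almost_product_absurd : False.
Proof.
have Kinf : infinite_set [set: K] by apply/infiniteP; exact: K_uncountable.1.
have [L [Lfin LP]] := free_basis_letters X_free.
have Lsmall (D : set F) : card_lt D [set: K] ->
    card_lt (\bigcup_(g in D) L g) [set: K].
  move=> DK; apply: (card_lt_bigcup Kinf DK K_uncountable) => g _.
  exact: finite_set_countable (Lfin g).
pose A a := \bigcup_(t in [set: F]) L (P t a / t).
pose B t := [set t] `|` \bigcup_(a in [set: F]) L (P t a / a).
have Asmall (Z : set F) : card_lt Z [set: K] ->
    card_lt (\bigcup_(a in Z) A a) [set: K].
  move=> /P_near_left[D DK DP]; apply: card_le_lt_trans (Lsmall D DK).
  apply: subset_card_le => x [a Za [t _ Lx]].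
  by exists (P t a / t) => //; exact: DP.
have Bsmall t : card_lt (B t) [set: K].
  apply: card_lt_setU => //; first exact: finite_card_lt.
  have [D DK DP] := P_near_right t; apply: card_le_lt_trans (Lsmall D DK).
  by apply: subset_card_le => x [a _ Lx]; exists (P t a / a).
(* A free pair (a, t) contradicts LP at w = P t a. *)
suff [a [t [Xa Xt Bta Aat]]] : exists a t, [/\ X a, X t, ~ B t a & ~ A a t].
  have [|Lx|Lx] := LP (P t a) a t Xa Xt.
  - by move=> eat; apply: Bta; left.
  - by apply: Bta; right; exists a.
  - by apply: Aat; exists t.
have [KG|[/card_eqPle[KG GK] sing]] := K_range.
  have [_ GX] := (card_eqPle _ _).1 X_card.
  apply: (free_pair_lt Kinf (card_lt_le_trans KG GX)) => // a _.
  have := Asmall _ (finite_card_lt Kinf (finite_set1 a)).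
  by rewrite bigcup_set1.
apply: (free_pair_singular sing X_card) => [t _|Z _ ZG].
  exact: card_lt_le_trans (Bsmall t) KG.
by apply: card_lt_le_trans KG; apply: Asmall; exact: card_lt_le_trans ZG GK.
Qed.

End Obstruction.

Theorem theorem2 (Gamma K : Type) (G F : groupType)
    (aleph0_lt_Gamma : card_lt [set: nat] [set: Gamma])
    (G_abelian : forall x y : G, (x * y)%g = (y * x)%g)
    (G_card : [set: G] #= [set: Gamma])
    (F_free : free_group_of_rank Gamma F)
    (K_range : (card_lt [set: nat] [set: K] /\ card_lt [set: K] [set: Gamma])
               \/ ([set: K] #= [set: Gamma] /\ singular Gamma)) :
  ~ coarsely_equivalent_groups K G F /\ ~ asymorphic_groups K G F.
Proof.
have K_uncountable : card_lt [set: nat] [set: K].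
  case: K_range => [[]//|[/card_eqPle[_ GK] _]].
  exact: card_lt_le_trans aleph0_lt_Gamma GK.
have Kinf : infinite_set [set: K] by apply/infiniteP; exact: K_uncountable.1.
have nce : ~ coarsely_equivalent_groups K G F.
  move=> /(almost_product Kinf G_abelian)[P [P_right P_left]].
  have [X [X_free X_card]] := F_free.
  apply: (almost_product_absurd K_uncountable X_free X_card _ P_right P_left).
  by case: K_range => [[_ ?]|?]; [left|right].
by split=> // /(asymorphic_coarsely_equivalent Kinf).
Qed.
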